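(* Let $\mathbf F_t$ belong to a rational reduced-rank $I(1)$ family with cointegration rank $c=r-q+d$, $q>d\ge0$ (as defined in the context), with $\boldsymbol\xi$ and $\boldsymbol\eta$ of full rank $r-c=q-d$. Let $\boldsymbol\eta_\perp$ be a $q\times d$ matrix whose columns are linearly independent and orthogonal to the columns of $\boldsymbol\eta$, and put $\overline{\boldsymbol\eta}=\boldsymbol\eta(\boldsymbol\eta'\boldsymbol\eta)^{-1}$, $\overline{\boldsymbol\eta}_\perp=\boldsymbol\eta_\perp(\boldsymbol\eta_\perp'\boldsymbol\eta_\perp)^{-1}$, $\mathbf v_{1t}=\boldsymbol\eta_\perp'\mathbf u_t$ (of dimension $d$), $\mathbf v_{2t}=\boldsymbol\eta'\mathbf u_t$ (of dimension $q-d=r-c$), $$\mathbf G_1(L)=\left(\mathbf D+(1-L)\mathbf E(L)\right)\overline{\boldsymbol\eta}_\perp,\qquad \mathbf G_2(L)=\left(\mathbf D+(1-L)\mathbf E(L)\right)\overline{\boldsymbol\eta}.$$ Then all the solutions of the difference equation $(1-L)\mathbf F_t=\mathbf S(L)^{-1}\mathbf C(L)\mathbf u_t$ can be written as $$\mathbf F_t=\mathbf S(L)^{-1}\left[\mathbf G_1(L)\mathbf v_{1t}+\mathbf G_2(L)\mathbf v_{2t}+\mathbf T_t\right]+\mathbf W,$$ where $\mathbf W$ is an $r$-dimensional random vector (constant in $t$) with coordinates in $L_2(\Omega,\mathcal F,P)$ and $$\mathbf T_t=\begin{cases}\boldsymbol\xi(\mathbf v_{21}+\mathbf v_{22}+\cdots+\mathbf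 v_{2t}), & t>0\\ \mathbf 0,& t=0\\ -\boldsymbol\xi(\mathbf v_{20}+\mathbf v_{2,-1}+\cdots+\mathbf v_{2,t+1}),& t<0.\end{cases}$$ Thus $\mathbf F_t$ is driven by the $r-c=q-d$ permanent shocks $\mathbf v_{2t}$ (the shocks entering the common trend $\mathbf T_t$, with full-rank loading matrix $\boldsymbol\xi$) and by the $d=q-(r-c)$ transitory shocks $\mathbf v_{1t}$ (which do not enter $\mathbf T_t$).
   Context: $L$ is the lag operator; processes are indexed by $t\in\mathbb Z$ and have coordinates in $L_2(\Omega,\mathcal F,P)$ for a probability space $(\Omega,\mathcal F,P)$. $\mathbf u_t$ is a $q$-dimensional zero-mean white noise with non-singular covariance matrix. **Rational reduced-rank $I(1)$ family with cointegration rank $c$.** Let $r>q>0$ and $r>c\ge r-q$. Consider couples $(\mathbf S(L),\mathbf C(L))$ where: (1) $\mathbf C(L)=\boldsymbol\xi\boldsymbol\eta'+(1-L)\mathbf D+(1-L)^2\mathbf E(L)$, with $\boldsymbol\xi$ of size $r\times(r-c)$, $\boldsymbol\eta$ of size $q\times(r-c)$, $\mathbf D$ of size $r\times q$, and $\mathbf E(L)$ an $r\times q$ matrix polynomial of degree $s_1\ge0$; (2) $\mathbf S(L)$ is an $r\times r$ matrix polynomial of degree $s_2\ge0$ with $\mathbf S(0)=\mathbf I_r$; (3) the vector $\mathbf p$ of all $\lambda=(r-c)(r+q)+rq(1+s_1)+r^2s_2$ real coefficients of $\boldsymbol\xi,\boldsymbol\eta,\mathbf D,\mathbf E(L),\mathbf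 S(L)$ varies in an open set $\Pi\subset\mathbb R^\lambda$, and for every $\mathbf p\in\Pi$, $\det\mathbf S(z)=0$ implies $|z|>1$. The family consists of the processes $\mathbf F_t$ such that $(1-L)\mathbf F_t=\mathbf S(L)^{-1}\mathbf C(L)\mathbf u_t$. Here $\mathbf S(L)^{-1}$ is the one-sided filter given by the power series expansion of $\mathbf S(z)^{-1}$ at $z=0$, whose coefficients decay exponentially. When $d=0$ the terms involving $\boldsymbol\eta_\perp$ are absent. *)

(* Defs.v *)
From HB Require Import structures.
From mathcomp Require Import all_boot all_order all_algebra.
From mathcomp Require Import complex.
From mathcomp Require Import all_classical all_reals all_analysis.
Set Implicit Arguments.
Unset Strict Implicit.
Unset Printing Implicit Defensive.
Import Order.TTheory GRing.Theory Num.Theory.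
Import numFieldNormedType.Exports.

Local Open Scope classical_set_scope.
Local Open Scope ring_scope.

(* Real matrices are seen as constant polynomial matrices; 'X plays the role
   of the lag operator L. *)
Definition cmx (R : nzRingType) (m n : nat) (A : 'M[R]_(m, n)) :
    'M[{poly R}]_(m, n) :=
  map_mx polyC A.

Definition coefmx (R : nzRingType) (m n : nat) (k : nat)
    (M : 'M[{poly R}]_(m, n)) : 'M[R]_(m, n) :=
  map_mx (fun a : {poly R} => a`_k) M.

Section InverseSeries.
Variables (R : comNzRingType) (n : nat).
Implicit Type S : 'M[{poly R}]_n.

(* First k coefficients of the power series S(z)^-1, assuming S(0) = I. *)
Fixpoint inv_series_seq S (k : nat) : seq 'M[R]_n :=
  if k is k'.+1 then
    let A := inv_series_seq S k' in
    rcons A ((k' == 0%N)%:R%:M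
             - \sum_(j < k') coefmx (k' - j) S *m nth 0 A j)
  else [::].

Definition inv_series S (k : nat) : 'M[R]_n :=
  nth 0 (inv_series_seq S k.+1) k.

Lemma size_inv_series_seq S k : size (inv_series_seq S k) = k.
Proof. by elim: k => //= k IHk; rewrite size_rcons IHk. Qed.

Lemma nth_inv_series_seq S k j : (j < k)%N ->
  nth 0 (inv_series_seq S k) j = inv_series S j.
Proof.
elim: k => // k IHk; rewrite ltnS leq_eqVlt => /orP[/eqP -> //|jk].
by rewrite /= nth_rcons size_inv_series_seq jk IHk.
Qed.

(* S(z) (A_0 + A_1 z + A_2 z^2 + ...) = I as formal power series. *)
Lemma mul_inv_series S k : coefmx 0 S = 1%:M ->
  \sum_(j < k.+1) coefmx (k - j) S *m inv_series S j = (k == 0%N)%:R%:M.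
Proof.
move=> S0; rewrite big_ord_recr /= subnn S0 mul1mx {2}/inv_series /=.
rewrite nth_rcons size_inv_series_seq ltnn eqxx.
rewrite [X in _ - X](eq_bigr (fun j : 'I_k =>
  coefmx (k - j) S *m inv_series S j)) ?subrKC // => j _.
by rewrite nth_inv_series_seq.
Qed.

End InverseSeries.

Section Processes.
Context {d : measure_display} {Om : measurableType d} {R : realType}.
Variable P : probability Om R.

Definition process (n : nat) := int -> Om -> 'cV[R]_n.

Definition L2_vector n (X : Om -> 'cV[R]_n) : Prop :=
  forall i, (fun w => X w i 0) \in Lfun P 2%:E.

Definition L2_process n (x : process n) : Prop := forall t, L2_vector (x t).

Definition white_noise q (u : process q) : Prop :=
  [/\ L2_process u,
      forall t i, ('E_P[(fun w => u t w i 0)%R] = 0)%E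
    & exists2 Gamma : 'M[R]_q, Gamma \in unitmx
      & forall s t i j,
          covariance P (fun w => u s w i 0) (fun w => u t w j 0)
          = (if s == t then Gamma i j else 0)%:E].

Definition add_process n (x y : process n) : process n :=
  fun t w => x t w + y t w.

(* (1 - L) x *)
Definition diff_process n (x : process n) : process n :=
  fun t w => x t w - x (t - 1) w.

Definition mul_process m n (A : 'M[R]_(m, n)) (x : process n) : process m :=
  fun t w => A *m x t w.

(* M(L) x, for a polynomial matrix M *)
Definition poly_filter m n (M : 'M[{poly R}]_(m, n)) (x : process n) :
    process m :=
  fun t w => \col_i \sum_j \sum_(k < size (M i j))
    (M i j)`_k * x (t - k%:Z) w j 0.

(* y_t = \sum_(k >= 0) A_k x_(t-k) for every t, the series converging
   coordinatewise in L_2(P). As an L_2-limit, y t is thereby determined only up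
   to P-almost sure equality. *)
Definition filtered m n (A : nat -> 'M[R]_(m, n)) (x : process n)
    (y : process m) : Prop :=
  forall t i,
    ('N[P]_2%:E [EFin \o (fun w =>
        (\sum_(k < N) A k *m x (t - k%:Z) w - y t w) i 0)%R])%E
    @[N --> \oo] --> 0%E.

(* T_t *)
Definition common_trend r m (xi : 'M[R]_(r, m)) (v2 : process m) : process r :=
  fun t w =>
    if 0 < t then xi *m \sum_(1 <= i < `|t|%N.+1) v2 i%:Z w
    else if t == 0 then 0
    else - (xi *m \sum_(0 <= i < `|t|%N) v2 (- i%:Z) w).

End Processes.

Section Family.
Variables (R : realType) (r q c s1 s2 : nat).

(* The space of coefficients (xi, eta, D, (E_0, ..., E_s1), (S_1, ..., S_s2)),
   with the product topology, i.e. the Euclidean space of all the entries. *)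
Definition params : topologicalType :=
  ('M[R]_(r, r - c) * 'M[R]_(q, r - c) * 'M[R]_(r, q)
   * 'rV['M[R]_(r, q)]_s1.+1 * 'rV['M[R]_r]_s2)%type.

Variable p : params.

Definition xi : 'M[R]_(r, r - c) := p.1.1.1.1.
Definition eta : 'M[R]_(q, r - c) := p.1.1.1.2.
Definition Dmx : 'M[R]_(r, q) := p.1.1.2.

Definition Epoly : 'M[{poly R}]_(r, q) :=
  \sum_(k < s1.+1) 'X^k *: cmx (p.1.2 0 k).

Definition Spoly : 'M[{poly R}]_r :=
  1%:M + \sum_(k < s2) 'X^(k.+1) *: cmx (p.2 0 k).

Definition Cpoly : 'M[{poly R}]_(r, q) :=
  cmx (xi *m eta^T) + (1 - 'X) *: cmx Dmx + (1 - 'X) ^+ 2 *: Epoly.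

Definition stable : Prop :=
  forall z : R[i], (map_poly (real_complex R) (\det Spoly)).[z] = 0 ->
    1 < `|z|.

(* (D + (1 - L) E(L)) B (B' B)^-1, which is G_1(L) for B = eta_perp and G_2(L)
   for B = eta *)
Definition Gpoly m (B : 'M[R]_(q, m)) : 'M[{poly R}]_(r, m) :=
  (cmx Dmx + (1 - 'X) *: Epoly) *m cmx (B *m invmx (B^T *m B)).

End Family.

Definition rational_reduced_rank_I1 (R : realType) (r q c s1 s2 : nat)
    (Pi : set (params R r q c s1 s2)) : Prop :=
  [/\ (0 < q < r)%N, (r - q <= c < r)%N, open Pi
    & forall p, Pi p -> stable p].

(* (1 - L) F_t = S(L)^-1 C(L) u_t *)
Definition I1_equation d (Om : measurableType d) (R : realType)
    (P : probability Om R) (r q c s1 s2 : nat) (p : params R r q c s1 s2)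
    (u : @process d Om R q) (F : @process d Om R r) : Prop :=
  filtered P (inv_series (Spoly p)) (poly_filter (Cpoly p) u)
    (diff_process F).

(* Main.v *)
Require Import Defs.
From mathcomp Require Import all_boot all_order all_algebra.
From mathcomp Require Import complex.
From mathcomp Require Import all_classical all_reals all_analysis.
From mathcomp Require Import measurable_realfun zify ring.
Set Implicit Arguments.
Unset Strict Implicit.
Unset Printing Implicit Defensive.
Import Order.TTheory GRing.Theory Num.Theory.
Import numFieldNormedType.Exports.

Local Open Scope classical_set_scope.
Local Open Scope ring_scope.

(** Put H(L) = D + (1 - L) E(L).  The matrices eta_perp and eta have full rank
    and orthogonal columns, and together they have q columns, so the two
    orthogonal projectors on their column spaces add up to the identity
    ([orthogonal_projectors_sum]).  Hence G_1(L) v_1 + G_2(L) v_2 = H(L) u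
    ([poly_filter_Gpoly]).  Since C(L) = xi eta' + (1 - L) H(L) and
    (1 - L) T_t = xi eta' u_t, the process x_t = H(L) u_t + T_t is a pathwise
    solution of (1 - L) x_t = C(L) u_t.

    It remains to undo the difference in (1 - L) F = S(L)^-1 (1 - L) x, up to a
    random vector W that does not depend on t ([filtered_integrate]).  Given
    that S(L)^-1 x_t converges in L_2 at t = 0, W is defined as the difference
    of F_0 and this limit.  The errors of the partial sums for F - W at t and at
    t - 1 differ by the error for (1 - L) F at t, which tends to 0, so the
    convergence at 0 propagates to all t in both directions.

    The convergence at t = 0 is where stability enters. The increments C(L) u_t
    of x are bounded in L_2, the variance of u_t being constant, so the norm of
    x_(-k) grows at most linearly in k, and it suffices that the coefficients
    A_k of S(z)^-1 satisfy sum (k + 1) |A_k| < oo: the series is then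
    absolutely convergent in norm and has a limit because L_2 is complete
    ([L2_series_cvg]). The bound on the A_k ([inv_series_first_moment]) comes
    from the formal identity det S(z) * S(z)^-1 = adj S(z), whose right-hand
    side is a polynomial. Over the complex numbers det S is, up to a nonzero
    constant, a product of linear factors z - z_i with |z_i| > 1, and dividing
    a power series by such a factor preserves the finiteness of the first
    absolute moment of its coefficients ([first_moment_linear_factor]). *)

(** * Dividing a power series by a stable polynomial *)

(** The k-th coefficient of the product of p by the power series with
    coefficients a. *)
Definition pconv (K : comNzRingType) (p : {poly K}) (a : nat -> K) (k : nat) :
    K :=
  \sum_(j < k.+1) p`_j * a (k - j)%N.

(** Coefficients of degree less than n only see the truncation of the series at
    order n, which reduces products with series to products of polynomials. *)
Lemma pconvE (K : comNzRingType) (p : {poly K}) (a : nat -> K) n k :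
  (k < n)%N ->
  pconv p a k = (p * \poly_(i < n) a i)`_k.
Proof.
move=> kn; rewrite coefM; apply: eq_bigr => j _.
by rewrite coef_poly (leq_ltn_trans (leq_subr _ _) kn).
Qed.

Lemma pconvM (K : comNzRingType) (p q : {poly K}) (a : nat -> K) k :
  pconv (p * q) a k = pconv p (pconv q a) k.
Proof.
rewrite (pconvE _ _ (ltnSn k)) -mulrA coefM; apply: eq_bigr => j _.
by rewrite (@pconvE _ q a k.+1)// ltnS leq_subr.
Qed.

Lemma pconv_map (K L : comNzRingType) (f : {rmorphism K -> L}) (p : {poly K})
    (a : nat -> K) k :
  pconv (map_poly f p) (f \o a) k = f (pconv p a k).
Proof.
rewrite /pconv rmorph_sum; apply: eq_bigr => j _.
by rewrite coef_map rmorphM.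
Qed.

Definition first_moment_bounded (K : numFieldType) (a : nat -> K) : Prop :=
  exists C : K, forall n, \sum_(k < n) k.+1%:R * `|a k| <= C.

Lemma eq_first_moment_bounded (K : numFieldType) (a b : nat -> K) : a =1 b ->
  first_moment_bounded a -> first_moment_bounded b.
Proof. by move=> /funext ->. Qed.

Lemma finite_support_first_moment (K : numFieldType) (a : nat -> K) N :
  (forall k, (N <= k)%N -> a k = 0) -> first_moment_bounded a.
Proof.
move=> a0; exists (\sum_(k < N) k.+1%:R * `|a k|) => n.
have ge0 m n' : 0 <= \sum_(m <= k < n') k.+1%:R * `|a k|.
  by apply: sumr_ge0 => k _; rewrite mulr_ge0.
rewrite -!(big_mkord xpredT (fun k => k.+1%:R * `|a k|)).
have [nN|/ltnW Nn] := leqP n N.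
  by rewrite [leRHS](big_cat_nat _ nN)//= lerDl.
rewrite (big_cat_nat _ Nn)//= [X in _ + X](_ : _ = 0) ?addr0//.
rewrite big_nat_cond big1// => k; rewrite andbT => /andP[Nk _].
by rewrite a0// normr0 mulr0.
Qed.

Lemma first_moment_scale (K : numFieldType) (c : K) (a : nat -> K) :
  c != 0 -> first_moment_bounded (fun k => c * a k) -> first_moment_bounded a.
Proof.
move=> c0 [C bC]; exists (`|c|^-1 * C) => n.
rewrite ler_pdivlMl ?normr_gt0// mulr_sumr.
under eq_bigr do rewrite mulrCA -normrM.
exact: bC.
Qed.

(** If b_k = a_(k-1) - z a_k, then |z| |a_k| <= |a_(k-1)| + |b_k|.  Summing with
    weights v_k gives |z| sum v_k |a_k| <= sum v_(k+1) |a_k| + sum v_k |b_k|.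
    For v = 1 the first sum on the right is absorbed on the left because
    |z| > 1, which bounds sum |a_k|; for v_k = k + 1 the excess
    v_(k+1) - v_k = 1 costs just this sum. *)
Lemma first_moment_linear_factor (K : numFieldType) (z : K) (a : nat -> K) :
  1 < `|z| -> first_moment_bounded (pconv ('X - z%:P) a) ->
  first_moment_bounded a.
Proof.
move=> z1 [C bC].
pose B0 n := \sum_(k < n) `|a k|; pose B1 n := \sum_(k < n) k.+1%:R * `|a k|.
pose b := pconv ('X - z%:P) a.
have b0 : b 0%N = - (z * a 0%N).
  by rewrite /b /pconv big_ord1 coefB coefX coefC/= sub0r mulNr.
have bS k : b k.+1 = a k - z * a k.+1.
  rewrite /b /pconv big_ord_recl big_ord_recl big1 => [|i _].
    rewrite !coefB !coefX !coefC/= /bump/= addn0 subn0 subn1/=; ring.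
  by rewrite /= !coefB !coefX !coefC/= subrr mul0r.
have step n (v : nat -> K) : (forall k, 0 <= v k) ->
    `|z| * (\sum_(k < n) v k * `|a k|) <=
    \sum_(k < n.-1) v k.+1 * `|a k| + \sum_(k < n) v k * `|b k|.
  move=> v0; case: n => [|n]; first by rewrite !big_ord0 mulr0 addr0.
  rewrite big_ord_recl [in leRHS]big_ord_recl/= mulrDr mulr_sumr addrCA.
  rewrite b0 normrN normrM mulrCA lerD2l -big_split/=; apply: ler_sum => i _.
  rewrite /bump/= add1n mulrCA -normrM -mulrDr ler_wpM2l//.
  have -> : z * a i.+1 = a i - b i.+1 by rewrite bS; ring.
  by rewrite (le_trans (ler_normB _ _)).
have z0 : 0 < `|z| - 1 by rewrite subr_gt0.
have leC n : \sum_(k < n) `|b k| <= C.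
  apply: le_trans (bC n); apply: ler_sum => i _.
  by rewrite ler_peMl// ler1n.
have mono (v : nat -> K) n : (forall k, 0 <= v k) ->
    \sum_(k < n.-1) v k * `|a k| <= \sum_(k < n) v k * `|a k|.
  by case: n => [|n] v0//=; rewrite [leRHS]big_ord_recr/= lerDl mulr_ge0.
have B0le n : B0 n <= C / (`|z| - 1).
  rewrite ler_pdivlMr// mulrC mulrBl mul1r lerBlDl.
  have := @step n (fun=> 1) (fun=> ler01).
  under eq_bigr do rewrite mul1r.
  move=> /le_trans; apply; apply: lerD.
    have := mono (fun=> 1) n (fun=> ler01).
    by under [leRHS]eq_bigr do rewrite mul1r.
  by under eq_bigr do rewrite mul1r.
exists ((C / (`|z| - 1) + C) / (`|z| - 1)) => n.
rewrite ler_pdivlMr// mulrC mulrBl mul1r lerBlDl.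
have := @step n (fun k => k.+1%:R) (fun=> ler0n _ _).
move=> /le_trans; apply; rewrite addrA; apply: lerD; last exact: bC.
rewrite (eq_bigr (fun k : 'I_n.-1 => k.+1%:R * `|a k| + `|a k|)); last first.
  by move=> k _; rewrite -natr1 mulrDl mul1r.
rewrite big_split/= lerD//; last exact: B0le.
by have := mono (fun k => k.+1%:R) n (fun=> ler0n _ _).
Qed.

Lemma first_moment_factors (K : numFieldType) (rs : seq K) (a : nat -> K) :
  (forall z, z \in rs -> 1 < `|z|) ->
  first_moment_bounded (pconv (\prod_(z <- rs) ('X - z%:P)) a) ->
  first_moment_bounded a.
Proof.
elim: rs a => [|z rs IH] a rs1.
  apply: eq_first_moment_bounded => k; rewrite big_nil /pconv big_ord_recl/=.
  rewrite subn0 coefC/= mul1r big1 ?addr0// => i _.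
  by rewrite coefC/= mul0r.
rewrite big_cons => h; apply: IH => [w wrs|].
  by rewrite rs1// inE wrs orbT.
apply: (@first_moment_linear_factor _ z); first by rewrite rs1// inE eqxx.
by apply: eq_first_moment_bounded h => k; rewrite pconvM.
Qed.

Lemma normr_real_complex (R : rcfType) (x : R) :
  `|real_complex R x| = real_complex R `|x|.
Proof. by rewrite normc_def/= expr0n addr0 sqrtr_sqr. Qed.

(** The roots are complex, so the factors of p are divided out over R[i]; the
    resulting bound is a complex number whose real part bounds the real sums. *)
Lemma first_moment_stable (R : rcfType) (p : {poly R}) (a : nat -> R) :
  (forall z : R[i], (map_poly (real_complex R) p).[z] = 0 -> 1 < `|z|) ->
  first_moment_bounded (pconv p a) -> first_moment_bounded a.
Proof.
move=> pst [C bC].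
set pc := map_poly _ p in pst.
have [rs pE] := closed_field_poly_normal pc.
(* A zero polynomial would vanish at 0, and 0 is not outside the unit disk. *)
have lc0 : lead_coef pc != 0.
  rewrite lead_coef_eq0; apply/eqP => pc0.
  by have := pst 0; rewrite pc0 horner0 normr0 ltr10 => /(_ erefl).
have [C' bC'] : first_moment_bounded (real_complex R \o a).
  apply: (@first_moment_factors _ rs) => [z zrs|].
    apply: pst; rewrite pE hornerZ; apply/eqP.
    by rewrite mulf_eq0 -[X in _ || X]/(root _ _) root_prod_XsubC zrs orbT.
  apply: (first_moment_scale lc0).
  have : first_moment_bounded (real_complex R \o pconv p a).
    exists (real_complex R C) => n.
    under eq_bigr do rewrite /= normr_real_complex
      -(rmorph_nat (real_complex R)) -rmorphM.
    by rewrite -rmorph_sum lecR.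
  apply: eq_first_moment_bounded => k.
  rewrite /= -pconv_map -/pc {1}pE /pconv mulr_sumr; apply: eq_bigr => j _.
  by rewrite coefZ mulrA.
exists (complex.Re C') => n.
have := bC' n.
under eq_bigr do rewrite /= normr_real_complex
  -(rmorph_nat (real_complex R)) -rmorphM.
by rewrite -rmorph_sum lecE => /andP[_].
Qed.

(** * Coefficients of the inverse filter *)

Section InverseFilter.
Context {R : realType} {n : nat}.
Variable S : 'M[{poly R}]_n.
Hypothesis S0 : coefmx 0 S = 1%:M.

(** det S(z) * S(z)^-1 = adj S(z) as formal power series.  With A the truncation
    of S(z)^-1 at order k + 1, S A agrees with the identity up to degree k, and
    the coefficients of degree k of det S A = adj S (S A) can be compared. *)
Lemma det_inv_series i j k :
  pconv (\det S) (fun m => inv_series S m i j) k = ((\adj S) i j)`_k.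
Proof.
pose A : 'M[{poly R}]_n := \matrix_(i, j) \poly_(m < k.+1) inv_series S m i j.
have SA l j' m : (m <= k)%N ->
    ((S *m A) l j')`_m = (m == 0%N)%:R * (l == j')%:R.
  move=> mk; have /matrixP/(_ l j') := mul_inv_series m S0.
  rewrite !mxE -[_ *+ _]mulr_natr => <-.
  rewrite coef_sum summxE.
  under eq_bigr do rewrite coefM.
  under [RHS]eq_bigr do rewrite !mxE.
  rewrite [RHS]exchange_big/=; apply: eq_bigr => x _.
  rewrite (reindex_inj rev_ord_inj)/=; apply: eq_bigr => y _.
  rewrite !mxE coef_poly subSS.
  have ym : (y <= m)%N by rewrite -ltnS.
  by rewrite subKn// (leq_ltn_trans _ (_ : m < k.+1)%N).
have /matrixP/(_ i j) : \det S *: A = \adj S *m (S *m A).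
  by rewrite mulmxA mul_adj_mx mul_scalar_mx.
rewrite [LHS]mxE [X in _ * X]mxE [RHS]mxE.
move=> /(congr1 (fun q : {poly R} => q`_k)).
rewrite -(@pconvE _ _ _ k.+1)// => ->.
rewrite coef_sum (bigD1 j)//= big1 ?addr0 => [|l lj].
  rewrite coefM big_ord_recr/= subnn SA// !eqxx !mulr1 big1 ?add0r// => m _.
  by rewrite SA ?leq_subr// subn_eq0 leqNgt ltn_ord mul0r mulr0.
by rewrite coefM big1// => m _; rewrite SA ?leq_subr// (negbTE lj) !mulr0.
Qed.

Lemma inv_series_first_moment :
  (forall z : R[i], (map_poly (real_complex R) (\det S)).[z] = 0 -> 1 < `|z|) ->
  forall i j, first_moment_bounded (fun k => inv_series S k i j).
Proof.
move=> Sst i j; apply: (first_moment_stable Sst).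
apply: (@finite_support_first_moment _ _ (size ((\adj S) i j))) => k szk.
by rewrite det_inv_series nth_default.
Qed.

End InverseFilter.

Lemma Spoly0 (R : realType) (r q c s1 s2 : nat) (p : params R r q c s1 s2) :
  coefmx 0 (Spoly p) = 1%:M.
Proof.
apply/matrixP => i j.
rewrite !mxE summxE coefD coef_sum big1 ?addr0 => [|k _].
  by rewrite -polyC1 -polyCMn coefC.
by rewrite !mxE coefXnM.
Qed.

(** * Orthogonal projectors *)

Section Gram.
Context {R : realFieldType}.

(** If v B'B = 0 then v B' has zero norm, as v B' B v' = 0. *)
Lemma gram_unitmx (m n : nat) (B : 'M[R]_(m, n)) :
  \rank B = n -> B^T *m B \in unitmx.
Proof.
move=> rB; rewrite -row_free_unit -kermx_eq0; apply/eqP/row_matrixP => i.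
rewrite row0; set v := row i _.
have vBB : v *m (B^T *m B) = 0.
  by apply/sub_kermxP; rewrite row_sub.
have Bv : v *m B^T = 0.
  apply/matrixP => a b; rewrite [RHS]mxE.
  have : ((v *m B^T) *m (v *m B^T)^T) a a = 0.
    by rewrite trmx_mul trmxK mulmxA -(mulmxA v) vBB mul0mx mxE.
  rewrite mxE => /eqP; rewrite psumr_eq0 => [/allP/(_ b)|k _]; last first.
    by rewrite [_^T _ _]mxE -expr2 sqr_ge0.
  by rewrite mem_index_enum [_^T _ _]mxE mulf_eq0 orbb => /(_ isT)/eqP.
have rBT : row_free B^T by rewrite /row_free mxrank_tr rB.
by apply: (row_free_inj rBT); rewrite Bv mul0mx.
Qed.

(** The square matrix (B1 B2) has a block diagonal invertible Gram matrix, hence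
    is invertible, and both sides of the equation act in the same way on its
    columns. *)
Lemma orthogonal_projectors_sum (q m1 m2 : nat)
    (B1 : 'M[R]_(q, m1)) (B2 : 'M[R]_(q, m2)) :
  (m1 + m2 = q)%N -> \rank B1 = m1 -> \rank B2 = m2 -> B1^T *m B2 = 0 ->
  B1 *m invmx (B1^T *m B1) *m B1^T + B2 *m invmx (B2^T *m B2) *m B2^T = 1%:M.
Proof.
move=> mq rB1 rB2 o12.
have o21 : B2^T *m B1 = 0 by rewrite -[LHS]trmxK trmx_mul trmxK o12 trmx0.
have U1 := gram_unitmx rB1; have U2 := gram_unitmx rB2.
pose Q := row_mx B1 B2.
have QQ : Q^T *m Q = block_mx (B1^T *m B1) 0 0 (B2^T *m B2).
  by rewrite /Q tr_row_mx mul_col_row o12 o21.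
have rQ : row_free Q.
  have QQu : Q^T *m Q \in unitmx.
    by rewrite QQ unitmxE det_ublock unitrM -!unitmxE U1 U2.
  have := mxrankM_maxr Q^T Q.
  rewrite (mxrank_unit QQu) [X in (X <= _)%N]mq => qr.
  by rewrite /row_free eqn_leq rank_leq_row qr.
apply/eqP; rewrite -subr_eq0; apply/eqP; apply: (row_free_inj rQ).
rewrite mul0mx mulmxBl mul1mx mulmxDl /Q !mul_mx_row -!mulmxA o12 o21.
rewrite !mulVmx// !mulmx0 !mulmx1 add_row_mx addr0 add0r.
exact: subrr.
Qed.

End Gram.

(** * Completeness of L_2 *)

Section SquareIntegrable.
Context {d : measure_display} {T : measurableType d} {R : realType}.
Variable P : probability T R.
Implicit Types (f g : T -> R) (c : R).

(** Measurability is included because Minkowski's inequality needs it, and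
    0 <= c so that the bounds can be squared. *)
Definition L2_le f c : Prop :=
  [/\ measurable_fun setT f, 0 <= c & ('N[P]_2%:E[EFin \o f] <= c%:E)%E].

Lemma L2_le_Lfun f c : L2_le f c -> f \in Lfun P 2%:E.
Proof.
move=> [mf c0 fc]; rewrite inE; apply/andP; split; rewrite inE//=.
exact: le_lt_trans fc (ltry _).
Qed.

Lemma Lfun_L2_le f : f \in Lfun P 2%:E -> exists c, L2_le f c.
Proof.
rewrite inE => /andP[/[!inE]/= mf ff]; exists (fine ('N[P]_2%:E[EFin \o f])).
split => //; first by rewrite fine_ge0// Lnorm_ge0.
by rewrite fineK// ge0_fin_numE// Lnorm_ge0.
Qed.

Lemma L2_le_weak f c c' : c <= c' -> L2_le f c -> L2_le f c'.
Proof.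
move=> cc' [mf c0 fc]; split => //; first exact: le_trans cc'.
by rewrite (le_trans fc)// lee_fin.
Qed.

Lemma L2_le0 : L2_le (cst 0) 0.
Proof. by split => //; rewrite Lnorm0. Qed.

Lemma L2_leD f g a b : L2_le f a -> L2_le g b -> L2_le (f \+ g) (a + b).
Proof.
move=> [mf a0 fa] [mg b0 gb]; split; [exact: measurable_funD|exact: addr_ge0|].
apply: (le_trans (minkowski_EFin _ mf mg _)); first by rewrite ler1n.
exact: leeD fa gb.
Qed.

Lemma L2_leZ f a k : L2_le f a -> L2_le (fun w => k * f w) (`|k| * a).
Proof.
move=> fa; have fL := L2_le_Lfun fa; have [mf a0 faN] := fa.
split; [exact: measurable_funM|exact: mulr_ge0|].
have := @LnormZ _ _ _ P 2%:E (lee1n 2) (Lfun_Sub (lee1n 2) fL) k.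
rewrite [X in ('N[_]__[X])%E](_ : _ = EFin \o (fun w => k * f w))// => ->.
by rewrite [leRHS]EFinM; apply: lee_wpmul2l faN; rewrite lee_fin.
Qed.

Lemma L2_leN f a : L2_le f a -> L2_le (fun w => - f w) a.
Proof.
move=> /(@L2_leZ _ _ (-1)); rewrite normrN1 mul1r.
rewrite (_ : (fun _ => _) = (fun w => - f w))//.
by apply/funext => w; rewrite mulN1r.
Qed.

Lemma L2_leB f g a b : L2_le f a -> L2_le g b -> L2_le (f \- g) (a + b).
Proof. by move=> fa /L2_leN gb; exact: L2_leD. Qed.

Lemma Lfun2D f g :
  f \in Lfun P 2%:E -> g \in Lfun P 2%:E -> f \+ g \in Lfun P 2%:E.
Proof.
move=> /Lfun_L2_le[a fa] /Lfun_L2_le[b gb]; exact: L2_le_Lfun (L2_leD fa gb).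
Qed.

Lemma Lfun2B f g :
  f \in Lfun P 2%:E -> g \in Lfun P 2%:E -> f \- g \in Lfun P 2%:E.
Proof.
move=> /Lfun_L2_le[a fa] /Lfun_L2_le[b gb]; exact: L2_le_Lfun (L2_leB fa gb).
Qed.

Lemma L2_le_sum (I : Type) (r : seq I) (Q : pred I) (f : I -> T -> R)
    (c : I -> R) : (forall i, Q i -> L2_le (f i) (c i)) ->
  L2_le (fun w => \sum_(i <- r | Q i) f i w) (\sum_(i <- r | Q i) c i).
Proof.
move=> fc; elim: r => [|i r IH].
  rewrite big_nil (_ : (fun _ => _) = cst 0); first exact: L2_le0.
  by apply/funext => w; rewrite big_nil.
rewrite big_cons; have [Qi|nQi] := ifP.
  rewrite (_ : (fun _ => _) = f i \+ (fun w => \sum_(i <- r | Q i) f i w)).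
    exact: L2_leD (fc i Qi) IH.
  by apply/funext => w; rewrite big_cons Qi.
rewrite (_ : (fun _ => _) = (fun w => \sum_(i <- r | Q i) f i w))//.
by apply/funext => w; rewrite big_cons nQi.
Qed.

Lemma L2_le_sqr f c : measurable_fun setT f -> 0 <= c ->
  L2_le f c <-> (\int[P]_w (f w ^+ 2)%:E <= (c ^+ 2)%:E)%E.
Proof.
move=> mf c0.
have NE : (\int[P]_w (f w ^+ 2)%:E = 'N[P]_2%:E[EFin \o f] `^ 2)%E.
  rewrite powR_Lnorm//; apply: eq_integral => w _ /=.
  by rewrite powR_mulrn// -normrX ger0_norm ?sqr_ge0.
have cE : (c ^+ 2)%:E = (c%:E `^ 2)%E by rewrite poweR_EFin powR_mulrn.
rewrite NE cE; split=> [[_ _ fc]|fc].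
  by apply: gt0_ler_poweR => //; rewrite in_itv/= ?Lnorm_ge0 ?lee_fin ?c0 leey.
have root x : (0 <= x -> (x `^ 2) `^ 2^-1 = x)%E.
  by move=> x0; rewrite -poweRrM divff// poweRe1.
split => //; rewrite -[leLHS]root ?Lnorm_ge0// -[leRHS]root ?lee_fin//.
by apply: gt0_ler_poweR fc => //; rewrite ?invr_ge0// in_itv/=
  ?lee_fin ?powR_ge0 ?poweR_ge0 leey.
Qed.

Lemma L2_le_mean f c : L2_le f c -> (\int[P]_w (`|f w|)%:E <= c%:E)%E.
Proof.
move=> [mf c0 fc].
(* Hoelder's inequality against the constant 1, whose norm is 1. *)
have := @hoelder _ _ _ P f (cst 1) 2 2 mf (measurable_cst _) _ _ _.
have PT := @probability_setT _ _ _ P.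
rewrite Lnorm_cst1 [X in (X `^ _)%E]PT poweR1r mule1 Lnorm1.
under eq_integral do rewrite /= mulr1.
have half2 : 2^-1 + 2^-1 = 1 :> R by rewrite [RHS]splitr !div1r.
by move=> /(_ ltac:(by []) ltac:(by []) half2)/le_trans; apply.
Qed.

(** Fatou's lemma for the squares. *)
Lemma L2_le_ae_lim (f : nat -> T -> R) g c :
  (forall n, L2_le (f n) c) -> measurable_fun setT g ->
  {ae P, forall w, f n w @[n --> \oo] --> g w} -> L2_le g c.
Proof.
move=> fc mg fg; have [_ c0 _] := fc 0%N.
have mf n : measurable_fun setT (f n) by case: (fc n).
have msq (h : T -> R) : measurable_fun setT h ->
    measurable_fun setT (fun w : T => (h w ^+ 2)%:E).
  by move=> mh; apply/measurable_EFinP; exact: measurable_funX.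
apply/(L2_le_sqr mg c0).
pose h n w := (f n w ^+ 2)%:E.
have mh n : measurable_fun setT (h n) by exact: msq.
have h0 n w : (0 <= h n w)%E by rewrite lee_fin sqr_ge0.
rewrite (ge0_ae_eq_integral _ _ _ _ _ (g := fun w => limn_einf (h ^~ w)))//.
- apply: (le_trans (fatou _ _ _ _)) => //.
  rewrite limn_einf_lim; apply: lime_le; first exact: is_cvg_einfs.
  apply: nearW => n; apply: (@le_trans _ _ (\int[P]_w h n w)%E).
    by apply: ereal_inf_lbound; exists n => /=.
  exact/L2_le_sqr.
- exact: msq.
- rewrite /limn_einf.
  apply: measurableT_comp => //.
  apply: measurable_fun_limn_esup => n.
  exact: measurableT_comp (mh n).
- by move=> w _; rewrite lee_fin sqr_ge0.
- move=> w _; rewrite limn_einf_lim; apply: lime_ge; first exact: is_cvg_einfs.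
  apply: nearW => n; apply: le_ereal_inf_tmp => _ [k /= _ <-]; exact: h0.
- apply: filterS fg => w fgw _.
  rewrite (cvg_limn_einf_sup (l := (g w ^+ 2)%:E))//.
  apply: cvg_EFin; first exact: nearW.
  exact: (@cvgM _ _ _ _ _ _ _ _ fgw fgw).
Qed.

(** The sum of the |X_k| has a finite integral, because on a probability space
    the L_1 norm is at most the L_2 norm; hence this sum is almost surely
    finite. *)
Lemma L2_series_ae_cvg (X : nat -> T -> R) (c : nat -> R) C :
  (forall k, L2_le (X k) (c k)) -> (forall n, \sum_(k < n) c k <= C) ->
  {ae P, forall w, cvgn (series (fun k => X k w))}.
Proof.
move=> Xc cC.
have mX k : measurable_fun setT (fun w => (`|X k w|)%:E).
  by case: (Xc k) => mX _ _; apply/measurable_EFinP; exact: measurableT_comp.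
pose G w := (\sum_(k <oo) (`|X k w|)%:E)%E.
have mG : measurable_fun setT G.
  apply: ge0_emeasurable_sum => // k w _ _; rewrite lee_fin; exact: normr_ge0.
have IG : (\int[P]_w G w <= C%:E)%E.
  rewrite integral_nneseries//; apply: lime_le.
    by apply: is_cvg_nneseries => n _ _; apply: integral_ge0.
  apply: nearW => n; apply: (@le_trans _ _ (\sum_(k < n) c k)%:E); last first.
    by rewrite lee_fin.
  rewrite big_mkord -sumEFin; apply: lee_sum => k _; exact: L2_le_mean.
have iG : P.-integrable setT G.
  apply/integrableP; split => //.
  under eq_integral do rewrite gee0_abs ?nneseries_ge0//.
  exact: le_lt_trans IG (ltry _).
apply: filterS (integrable_ae measurableT iG) => w /(_ I) Gw.
apply: normed_cvg; apply: nondecreasing_is_cvgn.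
  by apply/nondecreasing_series => k _ _ /=.
exists (fine (G w)) => _ [n _ <-].
rewrite -lee_fin fineK// /series/= -sumEFin; exact: nneseries_lim_ge.
Qed.

(** The Riesz-Fischer theorem for an absolutely convergent series.  The almost
    sure sum Y exists, and by Fatou's lemma the L_2 norm of Y minus the n-th
    partial sum is at most the n-th tail of the series of the bounds c_k. *)
Lemma L2_series_cvg (X : nat -> T -> R) (c : nat -> R) C :
  (forall k, L2_le (X k) (c k)) -> (forall n, \sum_(k < n) c k <= C) ->
  exists2 Y, Y \in Lfun P 2%:E &
    ('N[P]_2%:E [EFin \o (fun w => (\sum_(k < N) X k w - Y w)%R)])%E
      @[N --> \oo] --> 0%E.
Proof.
move=> Xc cC; have aeX := L2_series_ae_cvg Xc cC.
have c0 k : 0 <= c k by case: (Xc k).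
have mX k : measurable_fun setT (X k) by case: (Xc k).
have mS n : measurable_fun setT (fun w => series (fun k => X k w) n).
  by apply: measurable_sum.
(* The upper limit makes Y measurable, including where the series diverges. *)
pose Y w := fine (limn_esup (EFin \o series (fun k => X k w))).
have mY : measurable_fun setT Y.
  apply: measurableT_comp => //; apply: measurable_fun_limn_esup => n.
  exact/measurable_EFinP/mS.
have aeY : {ae P, forall w, series (fun k => X k w) n @[n --> \oo] --> Y w}.
  apply: filterS aeX => w /cvg_ex[l Xl].
  rewrite /Y (cvg_limn_einf_sup (l := l%:E))//.
  by apply: cvg_EFin => //; exact: nearW.
have cc : cvgn (series c).
  apply: nondecreasing_is_cvgn; first by apply/nondecreasing_series.
  by exists C => _ [n _ <-]; rewrite /series/= big_mkord.
pose tail n := limn (series c) - series c n.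
have lec n m : (n <= m)%N -> series c m - series c n <= tail n.
  move=> nm; rewrite lerD2r; apply: nondecreasing_cvgn_le => //.
  exact/nondecreasing_series.
have tailP n : L2_le (fun w => Y w - series (fun k => X k w) n) (tail n).
  apply: (@L2_le_ae_lim
    (fun m w => \sum_(n <= k < n + m) X k w)).
  - move=> m; apply: (@L2_le_weak _ (\sum_(n <= k < n + m) c k)).
      by rewrite -sub_series_geq ?leq_addr// lec// leq_addr.
    exact: L2_le_sum.
  - exact: measurable_funB.
  - apply: filterS aeY => w Yw.
    under eq_fun do rewrite -sub_series_geq ?leq_addr//.
    apply: cvgB; last exact: cvg_cst.
    rewrite (_ : (fun m => _) = [sequence series (fun k => X k w) (m + n)%N]_m).
      by rewrite cvg_shiftn.
    by apply/funext => m /=; rewrite addnC.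
exists Y.
  apply: (@L2_le_Lfun _ (tail 0%N)); have := tailP 0%N.
  rewrite (_ : (fun _ => _) = Y)//.
  by apply/funext => w; rewrite /series/= big_geq// subr0.
apply: (@squeeze_cvge _ _ _ _ (cst 0%E) _ (EFin \o tail)).
- apply: nearW => n; rewrite Lnorm_ge0/=.
  have [_ _] := L2_leN (tailP n); congr (_ <= _)%E; congr Lnorm.
  by apply/funext => w /=; rewrite opprB /series/= big_mkord.
- exact: cvg_cst.
- apply: cvg_EFin; first exact: nearW.
  by rewrite -[0](subrr (limn (series c))); apply: cvgB => //; exact: cvg_cst.
Qed.

End SquareIntegrable.

(** * Polynomial filters and the common trend *)

Section ProcessAlgebra.
Context {disp : measure_display} {Om : measurableType disp} {R : realType}.

Definition mxsize m n (M : 'M[{poly R}]_(m, n)) : nat :=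
  (\max_i \max_j size (M i j))%N.

Lemma leq_mxsize m n (M : 'M[{poly R}]_(m, n)) i j :
  (size (M i j) <= mxsize M)%N.
Proof.
apply: leq_trans (leq_bigmax i).
exact: (leq_bigmax (F := fun j => size (M i j)) j).
Qed.

(** A bound N common to all entries turns the filter into a sum of matrix
    products; it may be taken larger than needed so as to fit several
    polynomial matrices at once. *)
Lemma poly_filterE m n (M : 'M[{poly R}]_(m, n))
    (x : @process disp Om R n) N t w :
  (mxsize M <= N)%N ->
  poly_filter M x t w = \sum_(k < N) coefmx k M *m x (t - k%:Z) w.
Proof.
move=> MN; apply/colP => i; rewrite mxE summxE.
under [RHS]eq_bigr do rewrite mxE.
rewrite exchange_big/=; apply: eq_bigr => j _.
have sN : (size (M i j) <= N)%N := leq_trans (leq_mxsize M i j) MN.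
under [RHS]eq_bigr do rewrite mxE.
rewrite (big_ord_widen N (fun k => (M i j)`_k * x (t - k%:Z) w j 0) sN).
rewrite [RHS](bigID (fun k : 'I_N => (k < size (M i j))%N))/=.
rewrite [X in _ + X]big1 ?addr0// => k; rewrite -leqNgt => sk.
by rewrite nth_default// mul0r.
Qed.

Lemma poly_filterD m n (M1 M2 : 'M[{poly R}]_(m, n))
    (x : @process disp Om R n) t w :
  poly_filter (M1 + M2) x t w = poly_filter M1 x t w + poly_filter M2 x t w.
Proof.
pose N := maxn (mxsize (M1 + M2)) (maxn (mxsize M1) (mxsize M2)).
rewrite !(@poly_filterE _ _ _ _ N) ?leq_max ?leqnn ?orbT//.
rewrite -big_split; apply: eq_bigr => k _ /=.
rewrite -mulmxDl; congr (_ *m _).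
by apply/matrixP => i j; rewrite !mxE coefD.
Qed.

Lemma poly_filter_cmx m n (A : 'M[R]_(m, n)) (x : @process disp Om R n) t w :
  poly_filter (cmx A) x t w = A *m x t w.
Proof.
rewrite (@poly_filterE _ _ _ _ (mxsize (cmx A)).+1)// big_ord_recl subr0 big1.
  rewrite addr0; congr (_ *m _).
  by apply/matrixP => i j; rewrite !mxE coefC.
move=> k _; rewrite (_ : coefmx _ _ = 0) ?mul0mx//.
by apply/matrixP => i j; rewrite !mxE coefC.
Qed.

Lemma poly_filter_mulmx m n l (M : 'M[{poly R}]_(m, n)) (B : 'M[R]_(n, l))
    (x : @process disp Om R l) t w :
  poly_filter (M *m cmx B) x t w = poly_filter M (mul_process B x) t w.
Proof.
pose N := maxn (mxsize (M *m cmx B)) (mxsize M).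
rewrite !(@poly_filterE _ _ _ _ N) ?leq_max ?leqnn ?orbT//.
apply: eq_bigr => k _ /=; rewrite /mul_process mulmxA; congr (_ *m _).
apply/matrixP => i j; rewrite !mxE coef_sum; apply: eq_bigr => a _.
by rewrite !mxE coefMC.
Qed.

Lemma poly_filter_diff m n (M : 'M[{poly R}]_(m, n))
    (x : @process disp Om R n) t w :
  poly_filter ((1 - 'X) *: M) x t w = diff_process (poly_filter M x) t w.
Proof.
pose N := maxn (mxsize ((1 - 'X) *: M)) (mxsize M).
rewrite /diff_process (@poly_filterE _ _ _ _ N.+1); last first.
  by rewrite (@leq_trans N)// leq_max leqnn.
rewrite (@poly_filterE _ _ M _ N.+1); last first.
  by rewrite (@leq_trans N)// leq_max leqnn orbT.
rewrite (@poly_filterE _ _ M _ N); last by rewrite leq_max leqnn orbT.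
rewrite big_ord_recl [X in _ = X - _]big_ord_recl/= -addrA -sumrB.
congr (_ *m _ + _).
  by apply/matrixP => i j; rewrite !mxE mulrBl mul1r coefB coefXM subr0.
apply: eq_bigr => k _.
have -> : t - 1 - k%:Z = t - (bump 0 k)%:Z by rewrite /bump/= -addrA -opprD.
rewrite -mulmxBl; congr (_ *m _).
by apply/matrixP => i j; rewrite !mxE mulrBl mul1r coefB coefXM.
Qed.

Lemma common_trend_diff r m (xi : 'M[R]_(r, m)) (v : @process disp Om R m) t w :
  diff_process (common_trend xi v) t w = xi *m v t w.
Proof.
rewrite /diff_process; elim/int_ind: t => [|n _|n _].
- rewrite /common_trend/= big_nat1 sub0r opprK.
  by rewrite oppr0.
- have -> : n.+1%:Z - 1 = n%:Z by rewrite -addn1 PoszD addrK.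
  rewrite {1}/common_trend/= big_nat_recr//=.
  rewrite mulmxDr /common_trend.
  case: n => [|n]; last by rewrite /= addrC addKr.
  by rewrite /= big_geq// mulmx0 add0r subr0.
- have -> : - n.+1%:Z - 1 = - n.+2%:Z by rewrite -opprD -PoszD addn1.
  rewrite /common_trend/= opprK [X in _ + X](_ : _ =
    xi *m (\sum_(0 <= i < n.+1) v (- i%:Z) w + v (- n.+1%:Z) w)).
    by rewrite mulmxDr addKr.
  by rewrite big_nat_recr.
Qed.

End ProcessAlgebra.

(** * Integrating a filtered equation in L_2 *)

Section L2Processes.
Context {disp : measure_display} {Om : measurableType disp} {R : realType}.
Variable P : probability Om R.

Definition L2_bounded n (x : @process disp Om R n) : Prop :=
  exists M, forall t i, L2_le P (fun w => x t w i 0) M.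

Lemma L2_bounded_process n (x : @process disp Om R n) :
  L2_bounded x -> L2_process P x.
Proof. by move=> [M xM] t i; exact: L2_le_Lfun (xM t i). Qed.

Lemma L2_bounded_coord n (x : @process disp Om R n) :
  (forall i, exists M, forall t, L2_le P (fun w => x t w i 0) M) ->
  L2_bounded x.
Proof.
move=> /choice[M xM]; exists (\sum_i M i) => t i.
apply: L2_le_weak (xM i t); rewrite (bigD1 i)//= lerDl sumr_ge0// => j _.
by case: (xM j t).
Qed.

Lemma white_noise_bounded q (u : @process disp Om R q) :
  white_noise P u -> L2_bounded u.
Proof.
move=> [u2 u0 [G _ covG]]; apply: L2_bounded_coord => i.
exists (Num.sqrt (G i i)) => t.
have mu : measurable_fun setT (fun w => u t w i 0).
  by have [c []] := Lfun_L2_le (u2 t i).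
have Gi : (\int[P]_w (u t w i 0 ^+ 2)%:E = (G i i)%:E)%E.
  have := covG t t i i; rewrite eqxx unlock u0/= => <-.
  rewrite unlock; apply: eq_integral => w _ /=.
  by rewrite !fctE/= !subr0.
have G0 : 0 <= G i i.
  by rewrite -lee_fin -Gi integral_ge0// => w _; rewrite lee_fin sqr_ge0.
by apply/(L2_le_sqr _ mu (sqrtr_ge0 _)); rewrite Gi sqr_sqrtr.
Qed.

Lemma poly_filter_bounded m n (M : 'M[{poly R}]_(m, n))
    (x : @process disp Om R n) :
  L2_bounded x -> L2_bounded (poly_filter M x).
Proof.
move=> [c xc]; apply: L2_bounded_coord => i.
exists (\sum_j \sum_(k < size (M i j)) `|(M i j)`_k| * c) => t.
rewrite (_ : (fun _ => _) = fun w => \sum_j \sum_(k < size (M i j))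
    (M i j)`_k * x (t - k%:Z) w j 0); last by apply/funext => w; rewrite mxE.
by do 2 apply: L2_le_sum => ? _; exact: L2_leZ.
Qed.

Lemma L2_null_add (a b : nat -> Om -> R) :
  (forall N, a N \in Lfun P 2%:E) -> (forall N, b N \in Lfun P 2%:E) ->
  ('N[P]_2%:E[EFin \o a N])%E @[N --> \oo] --> 0%E ->
  ('N[P]_2%:E[EFin \o b N])%E @[N --> \oo] --> 0%E ->
  ('N[P]_2%:E[EFin \o (a N \+ b N)%R])%E @[N --> \oo] --> 0%E.
Proof.
move=> aL bL a0 b0.
have mL (f : Om -> R) : f \in Lfun P 2%:E -> measurable_fun setT f.
  by move=> /Lfun_L2_le[c []].
apply: (@squeeze_cvge _ _ _ _ (cst 0%E) _
  (fun N => 'N[P]_2%:E[EFin \o a N] + 'N[P]_2%:E[EFin \o b N])%E).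
- apply: nearW => N; rewrite Lnorm_ge0/=.
  by apply: minkowski_EFin; rewrite ?ler1n//; exact: mL.
- exact: cvg_cst.
- by rewrite -[0%E]adde0; apply: cvgeD.
Qed.

Lemma L2_diff_process n (x : @process disp Om R n) :
  L2_vector P (x 0) -> L2_process P (diff_process x) -> L2_process P x.
Proof.
move=> x0 dx; elim/int_ind => [//|k xk|k xk] i.
- rewrite (_ : (fun _ => _) = (fun w => diff_process x k.+1 w i 0)
    \+ (fun w => x k w i 0)).
    by apply: Lfun2D; [exact: dx|exact: xk].
  apply/funext => w /=; rewrite /diff_process !mxE.
  by rewrite -[in k.+1%:Z - 1]addn1 PoszD addrK subrK.
- rewrite (_ : (fun _ => _) = (fun w => x (- k%:Z) w i 0)
    \- (fun w => diff_process x (- k%:Z) w i 0)).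
    by apply: Lfun2B; [exact: xk|exact: dx].
  apply/funext => w /=; rewrite /diff_process !mxE.
  by rewrite -opprD -PoszD addn1 subKr.
Qed.

(** Minkowski's inequality along x_(-k-1) = x_(-k) - (x_(-k) - x_(-k-1)). *)
Lemma diff_process_growth n (x : @process disp Om R n) :
  L2_vector P (x 0) -> L2_bounded (diff_process x) ->
  exists M, forall k i, L2_le P (fun w => x (- k%:Z) w i 0) (M * k.+1%:R).
Proof.
move=> x0 [M dxM].
have /choice[c xc] : forall i, exists c, L2_le P (fun w => x 0 w i 0) c.
  by move=> i; apply: Lfun_L2_le; exact: x0.
exists (\sum_i c i + M) => k i.
have c0 : c i <= \sum_i c i.
  by rewrite (bigD1 i)//= lerDl sumr_ge0// => j _; case: (xc j).
have ci0 : 0 <= \sum_i c i by apply: le_trans c0; case: (xc i).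
have M0 : 0 <= M by case: (dxM 0 i).
elim: k => [|k IH].
  rewrite mulr1 oppr0; apply: L2_le_weak (xc i).
  by rewrite (le_trans c0)// lerDl.
have := L2_leB IH (dxM (- k%:Z) i).
rewrite (_ : _ \- _ = fun w => x (- k.+1%:Z) w i 0); last first.
  apply/funext => w /=; rewrite /diff_process !mxE.
  by rewrite -opprD -PoszD addn1 subKr.
apply: L2_le_weak; rewrite -[in leRHS]natr1 mulrDr mulr1 lerD2l.
by rewrite lerDr.
Qed.

Lemma filtered_summable m n (A : nat -> 'M[R]_(m, n))
    (x : @process disp Om R n) M :
  (forall i j, first_moment_bounded (fun k => A k i j)) ->
  (forall k i, L2_le P (fun w => x (- k%:Z) w i 0) (M * k.+1%:R)) ->
  forall i, exists2 Y, Y \in Lfun P 2%:E &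
    ('N[P]_2%:E [EFin \o (fun w =>
       ((\sum_(k < N) A k *m x (- k%:Z) w) i 0 - Y w)%R)])%E
      @[N --> \oo] --> 0%E.
Proof.
move=> Afm xM i.
have /choice[C AC] := Afm i.
pose c k := \sum_j `|A k i j| * (M * k.+1%:R).
have cC N : \sum_(k < N) c k <= \sum_j `|M| * C j.
  rewrite exchange_big/=; apply: ler_sum => j _.
  apply: le_trans (ler_wpM2l (normr_ge0 M) (AC j N)).
  rewrite mulr_sumr; apply: ler_sum => k _.
  rewrite mulrC -mulrA; apply: ler_wpM2r; last exact: ler_norm.
  by rewrite mulr_ge0.
have Xc k : L2_le P (fun w => (A k *m x (- k%:Z) w) i 0) (c k).
  rewrite (_ : (fun _ => _) = fun w => \sum_j A k i j * x (- k%:Z) w j 0).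
    by apply: L2_le_sum => j _; exact: L2_leZ.
  by apply/funext => w; rewrite mxE.
have [Y YL Ylim] := L2_series_cvg Xc cC; exists Y => //.
by under eq_fun do under eq_fun do rewrite summxE.
Qed.

(** The filter applied to x converges at t = 0, by the linear growth of x and
    the finite first moments of A, and W makes F_0 - W its limit.  The rest is
    an induction on t in both directions: the error e at t for the pair
    (x, F - W) is the error at t - 1 plus the error at t for the differenced
    pair. *)
Lemma filtered_integrate m n (A : nat -> 'M[R]_(m, n))
    (x : @process disp Om R n) (F : @process disp Om R m) :
  (forall i j, first_moment_bounded (fun k => A k i j)) ->
  L2_vector P (x 0) -> L2_bounded (diff_process x) -> L2_process P F ->
  filtered P A (diff_process x) (diff_process F) ->
  exists2 W, L2_vector P W & filtered P A x (fun t w => F t w - W w).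
Proof.
move=> Afm x0 dx F2 dF.
have [M xM] := diff_process_growth x0 dx.
have x2 := L2_diff_process x0 (L2_bounded_process dx).
have /choice[Y YP] : forall i, exists Y, Y \in Lfun P 2%:E /\
    ('N[P]_2%:E [EFin \o (fun w =>
       ((\sum_(k < N) A k *m x (- k%:Z) w) i 0 - Y w)%R)])%E
      @[N --> \oo] --> 0%E.
  by move=> i; have [Y ? ?] := filtered_summable Afm xM i; exists Y.
pose W w := F 0 w - \col_i Y i w.
have W2 : L2_vector P W.
  move=> i; rewrite (_ : (fun _ => _) = (fun w => F 0 w i 0) \- Y i).
    by apply: Lfun2B; [exact: F2|exact: (YP i).1].
  by apply/funext => w; rewrite !mxE.
exists W => //.
pose e (y : @process disp Om R n) (G : @process disp Om R m) t i N w :=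
  (\sum_(k < N) A k *m y (t - k%:Z) w - G t w) i 0.
have eL y G t i N : L2_process P y -> L2_process P G ->
    e y G t i N \in Lfun P 2%:E.
  move=> y2 G2; rewrite (_ : e _ _ _ _ _ = (fun w => \sum_(k < N) \sum_j
      A k i j * y (t - k%:Z) w j 0) \- (fun w => G t w i 0)); last first.
    apply/funext => w; rewrite /e !mxE summxE; congr (_ - _).
    by apply: eq_bigr => k _; rewrite mxE.
  apply: Lfun2B; last exact: G2.
  have /choice[c yc] : forall k, exists c : 'I_n -> R, forall j,
      L2_le P (fun w => y (t - k%:Z) w j 0) (c j).
    move=> k; have /choice[c yc] : forall j, exists c,
        L2_le P (fun w => y (t - k%:Z) w j 0) c.
      by move=> j; apply: Lfun_L2_le; exact: y2.
    by exists c.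
  apply: (@L2_le_Lfun _ _ _ _ _ (\sum_(k < N) \sum_j `|A k i j| * c k j)).
  by apply: L2_le_sum => k _; apply: L2_le_sum => j _; exact/L2_leZ/yc.
pose FW : process m := fun t w => F t w - W w.
have FW2 : L2_process P FW.
  move=> t i; rewrite (_ : (fun _ => _) =
      (fun w => F t w i 0) \- (fun w => W w i 0)).
    by apply: Lfun2B; [exact: F2|exact: W2].
  by apply/funext => w; rewrite [LHS]mxE [in LHS]mxE.
have dx2 := L2_bounded_process dx.
have dF2 : L2_process P (diff_process F).
  move=> t i; rewrite (_ : (fun _ => _) =
      (fun w => F t w i 0) \- (fun w => F (t - 1) w i 0)).
    by apply: Lfun2B; exact: F2.
  by apply/funext => w; rewrite !mxE.
have step t i N w : e x FW t i N w =
    e (diff_process x) (diff_process F) t i N w + e x FW (t - 1) i N w.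
  rewrite /e /FW /diff_process.
  have -> : \sum_(k < N) A k *m (x (t - k%:Z) w - x (t - k%:Z - 1) w) =
      \sum_(k < N) A k *m x (t - k%:Z) w -
      \sum_(k < N) A k *m x (t - 1 - k%:Z) w.
    rewrite -sumrB; apply: eq_bigr => k _.
    by rewrite mulmxBr (addrAC t).
  move: (\sum_(k < N) _) (\sum_(k < N) _) (F t w) (F (t - 1) w) (W w).
  by move=> S1 S2 f1 f2 W0; rewrite !mxE; ring.
pose nrm (f : Om -> R) := ('N[P]_2%:E[EFin \o f])%E.
elim/int_ind => [i|k IH i|k IH i].
- have [_] := YP i.
  rewrite (_ : (fun N => _) = (fun N => nrm (e x FW 0 i N)))//.
  apply/funext => N; congr Lnorm; apply/funext => w /=; congr EFin.
  rewrite /e /FW /W; under [in RHS]eq_bigr do rewrite sub0r.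
  move: (\sum_(k < N) _) (F 0 w) => S f.
  by rewrite !mxE; ring.
- rewrite (_ : (fun N => _) = fun N => nrm (
    e (diff_process x) (diff_process F) k.+1 i N \+ e x FW k i N)).
    by apply: L2_null_add => [N|N||]; [exact: eL|exact: eL|exact: dF|exact: IH].
  apply/funext => N; congr Lnorm; apply/funext => w /=; congr EFin.
  by rewrite -[LHS]/(e x FW k.+1 i N w) step -[in k.+1%:Z - 1]addn1 PoszD addrK.
- rewrite (_ : (fun N => _) = fun N => nrm (e x FW (- k%:Z) i N \+
    (fun w => - e (diff_process x) (diff_process F) (- k%:Z) i N w))).
    apply: L2_null_add => [N|N||]; [exact: eL| |exact: IH|].
      have [c /L2_leN] := Lfun_L2_le (eL _ _ (- k%:Z) i N dx2 dF2).
      exact: L2_le_Lfun.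
    have := dF (- k%:Z) i; rewrite (_ : (fun N => _) = fun N =>
        nrm (fun w => - e (diff_process x) (diff_process F) (- k%:Z) i N w))//.
    by apply/funext => N; rewrite -[LHS]oppe_Lnorm.
  apply/funext => N; congr Lnorm; apply/funext => w /=; congr EFin.
  rewrite -[LHS]/(e x FW (- k.+1%:Z) i N w) [in RHS]step -opprD -PoszD addn1.
  by rewrite addrAC subrr add0r.
Qed.

End L2Processes.

(** * The representation *)

Section Representation.
Context {disp : measure_display} {Om : measurableType disp} {R : realType}.

Lemma CpolyE (r q c s1 s2 : nat) (p : params R r q c s1 s2) :
  Cpoly p = cmx (xi p *m (eta p)^T) +
    (1 - 'X) *: (cmx (Dmx p) + (1 - 'X) *: Epoly p).
Proof. by rewrite /Cpoly scalerDr scalerA -expr2 addrA. Qed.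

Lemma poly_filter_Gpoly (r q c s1 s2 d : nat) (p : params R r q c s1 s2)
    (eta_perp : 'M[R]_(q, d)) (u : @process disp Om R q) t w :
  (d + (r - c) = q)%N -> \rank eta_perp = d -> \rank (eta p) = (r - c)%N ->
  eta_perp^T *m eta p = 0 ->
  poly_filter (Gpoly p eta_perp) (mul_process eta_perp^T u) t w +
  poly_filter (Gpoly p (eta p)) (mul_process (eta p)^T u) t w =
  poly_filter (cmx (Dmx p) + (1 - 'X) *: Epoly p) u t w.
Proof.
move=> dq rperp reta orth.
rewrite -!poly_filter_mulmx -poly_filterD /Gpoly -!mulmxA -mulmxDr.
rewrite /cmx -!map_mxM -map_mxD.
by rewrite orthogonal_projectors_sum// map_mx1 mulmx1.
Qed.

End Representation.

Theorem mainTheorem2 (disp : measure_display) (Om : measurableType disp)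
    (R : realType) (P : probability Om R) (r q c d s1 s2 : nat)
    (Pi : set (params R r q c s1 s2)) (p : params R r q c s1 s2)
    (u : @process disp Om R q) (F : @process disp Om R r)
    (eta_perp : 'M[R]_(q, d))
    (hPi : rational_reduced_rank_I1 Pi) (hp : Pi p)
    (hu : white_noise P u)
    (hd : (d < q)%N) (hc : c = (r - q + d)%N)
    (hxi : \rank (xi p) = (r - c)%N) (heta : \rank (eta p) = (r - c)%N)
    (hperp : \rank eta_perp = d) (horth : eta_perp^T *m eta p = 0)
    (hF : L2_process P F) (hsol : I1_equation P p u F) :
  let v1 := mul_process eta_perp^T u in
  let v2 := mul_process (eta p)^T u in
  let G1 := Gpoly p eta_perp in
  let G2 := Gpoly p (eta p) in
  let T := common_trend (xi p) v2 in
  [/\ exists2 W : Om -> 'cV[R]_r, L2_vector P W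
      & filtered P (inv_series (Spoly p))
          (add_process
             (add_process (poly_filter G1 v1) (poly_filter G2 v2)) T)
          (fun t w => F t w - W w),
      (r - c = q - d)%N, d = (q - (r - c))%N
    & \rank (xi p) = (r - c)%N].
Proof.
move=> v1 v2 G1 G2 T.
have [/andP[_ qr] _ _ stab] := hPi.
have rc : (r - c = q - d)%N by lia.
split => //; last by lia.
set x := add_process _ _.
pose H := cmx (Dmx p) + (1 - 'X) *: Epoly p.
have xE t w : x t w = poly_filter H u t w + T t w.
  by rewrite /x /add_process poly_filter_Gpoly//; lia.
have dxE : diff_process x = poly_filter (Cpoly p) u.
  apply/funext => t; apply/funext => w.
  rewrite CpolyE poly_filterD poly_filter_cmx poly_filter_diff -mulmxA.
  rewrite -(common_trend_diff (xi p) v2) /diff_process !xE.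
  by rewrite opprD addrACA addrC.
have ub := white_noise_bounded hu.
apply: filtered_integrate => //.
- exact: inv_series_first_moment (Spoly0 p) (stab p hp).
- move=> i; rewrite (_ : (fun _ => _) = (fun w => poly_filter H u 0 w i 0)).
    exact: (L2_bounded_process (poly_filter_bounded H ub)).
  by apply/funext => w; rewrite xE /T /common_trend/= addr0.
- by rewrite dxE; exact: poly_filter_bounded.
- by rewrite dxE.
Qed.
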